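(* Let $Q \subset \mathbb{R}^2$ be a planar convex shape, let $D$ be a largest disk contained in $Q$, and let $P \subset \mathbb{R}^2$ be a convex shape that can be placed in $Q$ in every orientation. Then $\mathrm{peri}(P) \leq \mathrm{peri}(D)$.
   Context: A planar convex shape is a nonempty compact convex subset of $\mathbb{R}^2$. A convex shape $P$ can be placed in $Q$ in every orientation if for every rotation $\rho \in SO(2)$ there is a translation vector $t \in \mathbb{R}^2$ with $\rho P + t \subseteq Q$. A largest disk contained in $Q$ is a closed disk of maximum radius contained in $Q$ (a single point counts as a disk of radius $0$). $\mathrm{peri}(P)$ denotes the perimeter of $P$, i.e. the length of its boundary; for a line segment it is understood as twice the length of the segment, and for a point it is $0$. *)

(* Defs.v *)
From mathcomp Require Import all_boot all_order all_algebra.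
From mathcomp Require Import all_classical all_reals all_analysis.

Set Implicit Arguments.
Unset Strict Implicit.
Unset Printing Implicit Defensive.

Import Order.TTheory GRing.Theory Num.Theory.
Import numFieldNormedType.Exports.

Local Open Scope classical_set_scope.
Local Open Scope ring_scope.

(* The library norm `|v| on 'rV[R]_2 is the sup norm.  It induces the usual   *)
(* topology, but lengths and disks have to be taken in the Euclidean norm.    *)
Definition enorm (R : realType) (v : 'rV[R]_2) : R :=
  Num.sqrt (\sum_(i < 2) v ord0 i ^+ 2).

Definition convex_shape (R : realType) (A : set 'rV[R]_2) : Prop :=
  [/\ A !=set0, compact A & @convex_set R 'rV[R]_2 A].

(* A rotation acts on row vectors by x |-> x *m M. *)
Definition rotation (R : realType) (M : 'M[R]_2) : Prop :=
  M *m M^T = 1%:M /\ \det M = 1.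

Definition placeable_in_every_orientation (R : realType)
    (P Q : set 'rV[R]_2) : Prop :=
  forall M : 'M[R]_2, rotation M ->
    exists t : 'rV[R]_2, [set x *m M + t | x in P] `<=` Q.

Definition closed_disk (R : realType) (c : 'rV[R]_2) (r : R) : set 'rV[R]_2 :=
  [set x | enorm (x - c) <= r].

Definition largest_disk (R : realType) (Q D : set 'rV[R]_2) : Prop :=
  exists (c : 'rV[R]_2) (r : R),
    [/\ 0 <= r, D = closed_disk c r, D `<=` Q &
        forall (c' : 'rV[R]_2) (r' : R),
          0 <= r' -> closed_disk c' r' `<=` Q -> r' <= r].

Definition boundary (T : topologicalType) (A : set T) : set T :=
  closure A `\` interior A.

Definition segment (R : realType) (a b : 'rV[R]_2) : set 'rV[R]_2 :=
  [set (1 - t) *: a + t *: b | t in `[0, 1]%classic].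

(* Length of the chain gamma(a), gamma(s_0), ..., gamma(s_(n-1)); this is the *)
(* analogue of the library's [variation] for curves in the plane.             *)
Definition chain_length (R : realType) (gamma : R -> 'rV[R]_2) (a b : R)
    (s : seq R) : R :=
  let F := gamma \o nth b (a :: s) in
  \sum_(0 <= i < size s) enorm (F i.+1 - F i).

Definition curve_length (R : realType) (gamma : R -> 'rV[R]_2) (a b : R) :
    \bar R :=
  ereal_sup [set (chain_length gamma a b s)%:E | s in itv_partition a b].

Definition simple_closed_parametrization (R : realType) (A : set 'rV[R]_2)
    (gamma : R -> 'rV[R]_2) : Prop :=
  [/\ {within `[0, 1]%classic, continuous gamma},
      gamma 0 = gamma 1,
      set_inj `[0, 1[%classic gamma &
      gamma @` `[0, 1]%classic = A].

(* All simple closed parametrizations of a set have the same length, so this  *)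
(* is the supremum of a singleton whenever A is a simple closed curve.        *)
Definition closed_curve_length (R : realType) (A : set 'rV[R]_2) : \bar R :=
  ereal_sup [set curve_length gamma 0 1 |
             gamma in simple_closed_parametrization A].

(* The endpoints of a segment are unique up to order, so this is again the    *)
(* supremum of a singleton whenever A is a segment.                           *)
Definition segment_length (R : realType) (A : set 'rV[R]_2) : \bar R :=
  ereal_sup [set l | exists a b, A = segment a b /\ l = (enorm (b - a))%:E].

(* A convex shape is either a segment (a point being [segment a a]) or has    *)
(* nonempty interior, in which case its boundary is a simple closed curve.    *)
Definition perimeter (R : realType) (A : set 'rV[R]_2) : \bar R :=
  if `[< exists a b : 'rV[R]_2, A = segment a b >]
  then (2%:E * segment_length A)%E
  else closed_curve_length (boundary A).

(* Main.v *)
Require Import Defs.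
From mathcomp Require Import all_boot all_order all_algebra.
From mathcomp Require Import all_classical all_reals all_analysis.
From mathcomp Require Import measurable_realfun ring lra.

Set Implicit Arguments.
Unset Strict Implicit.
Unset Printing Implicit Defensive.

Import Order.TTheory GRing.Theory Num.Theory.
Import numFieldNormedType.Exports.

Local Open Scope classical_set_scope.
Local Open Scope ring_scope.

(** Averaging the rotated copies of P gives a disk.  For every rotation M some
    translate of P M lies in Q, and Q is convex, so the Minkowski mean of these
    translates over all rotations also lies in Q.  The support function of the
    mean in the direction u is, up to the translation, the mean over M of the
    support function of P in the direction u M^T; this does not depend on u, and
    by Cauchy's formula it equals peri(P) / (2 pi).  So Q contains a disk of
    perimeter peri(P), which cannot be larger than the largest disk D.

    Integrals over the circle are avoided by using only the rotations by
    k pi / N and k pi / N + pi for k < N.  Pairing M with - M replaces support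
    functions by widths.  Let L be the length of a chain inscribed in the
    boundary of P, with edges v.

    - Cauchy's formula is replaced by an inequality ([sum_sinusoid_ge]): for
      every vector v and every unit vector u, the sum over k < N of
      |dot (v M_k) u| is at least |v| cot (pi / 2N).
    - For every u, the sum of |dot v u| over the edges v is at most twice the
      width of P in the direction u ([boundary_chain_width_bounds]).  Indeed a
      line that has points of P strictly on both sides meets the boundary of P
      at most twice ([line_meets_boundary_twice]), so that, along a simple
      closed parametrization of the boundary, the function dot _ u takes every
      value strictly between its extrema at most twice; such a function has
      variation at most twice its oscillation
      ([variation_le_two_preimages]).
    - Hence the mean of the 2N copies of P has support at least
      L cot (pi / 2N) / 4N around some centre in every direction.  By
      separation Q contains the disk of that radius ([placeable_disk]), and the
      maximality of the radius r of D gives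
      L cos (pi / 2N) <= 4 N r sin (pi / 2N).

    The right-hand side is the perimeter of the regular 2N-gon inscribed in D,
    so it is at most peri(D) ([polygon_le_perimeter_disk]).  Letting N tend to
    infinity yields L <= peri(D), for every inscribed chain.  When P is a
    segment, the chain that runs along it and back plays the same part. *)

(** * Sums of equally spaced values of a sinusoid *)

Section Trigonometry.
Context {R : realType}.
Implicit Types (A B x h : R) (N j k : nat).

Definition sinusoid A B x : R := A * cos x + B * sin x.

Lemma sinusoidDpi A B x : sinusoid A B (x + pi) = - sinusoid A B x.
Proof. by rewrite /sinusoid cosDpi sinDpi; ring. Qed.

(** Up to the factor 2 sin h, a sinusoid is the increment over [x - h, x + h] of
    its conjugate sinusoid; sums with step 2h therefore telescope. *)
Lemma sinusoid_telescope A B x h :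
  2 * sin h * sinusoid A B x =
  sinusoid B (- A) (x - h) - sinusoid B (- A) (x + h).
Proof. by rewrite /sinusoid cosB sinB cosD sinD; ring. Qed.

(** The absolute value of a sinusoid has period pi, so N consecutive samples with
    step pi / N always cover one period. *)
Lemma sinusoid_window A B N j : (0 < N)%N ->
  \sum_(j <= k < j + N) `|sinusoid A B (k%:R * (pi / N%:R))| =
  \sum_(0 <= k < N) `|sinusoid A B (k%:R * (pi / N%:R))|.
Proof.
move=> N0; elim: j => [|j IHj]; first by rewrite add0n.
have jjN : (j < j + N)%N by rewrite -{1}(addn0 j) ltn_add2l.
rewrite -IHj addSn big_nat_recr//= [in RHS]big_ltn// addrC; congr (_ + _).
have -> : (j + N)%:R * (pi / N%:R) = j%:R * (pi / N%:R) + pi :> R.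
  by rewrite natrD; field; rewrite pnatr_eq0 -lt0n.
by rewrite sinusoidDpi normrN.
Qed.

(** The samples of index 0 and N are opposite, hence the sign changes somewhere
    in between. *)
Lemma sinusoid_sign_change A B N : (0 < N)%N ->
  exists2 j, (j < N)%N &
    sinusoid A B (j%:R * (pi / N%:R)) * sinusoid A B (j.+1%:R * (pi / N%:R))
      <= 0.
Proof.
move=> N0; set C := fun k => sinusoid A B (k%:R * (pi / N%:R)).
have CN : C N = - C 0%N.
  by rewrite /C mulrCA divff ?pnatr_eq0 -?lt0n// mulr1 mul0r -[pi]add0r sinusoidDpi.
apply: contrapT => noj.
have pos k : (k < N)%N -> 0 < C k * C k.+1.
  by move=> kN; rewrite ltNge; apply/negP => le0; apply: noj; exists k.
have : 0 < C 0%N * C N.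
  rewrite -(ltn_predK N0).
  suff H k : (k < N)%N -> 0 < C 0%N * C k.+1 by apply: H; rewrite (ltn_predK N0).
  elim: k => [|k IHk] kN; first exact: pos.
  have := mulr_gt0 (IHk (ltnW kN)) (pos _ kN).
  have -> : C 0%N * C k.+1 * (C k.+1 * C k.+2) = C k.+1 ^+ 2 * (C 0%N * C k.+2) by ring.
  have := sqr_ge0 (C k.+1); rewrite le_eqVlt => /predU1P[<-|]; first by rewrite mul0r ltxx.
  by move=> c0; rewrite pmulr_rgt0.
by rewrite CN mulrN oppr_gt0 -expr2 ltNge sqr_ge0.
Qed.

(** Discrete form of: the mean of |A cos x + B sin x| over a period is 2 / pi
    times its amplitude.  Start the summation window just after a sign change.
    Times sin h, the sum of the samples, without absolute values, telescopes to
    the value of the conjugate sinusoid S at the midpoint y of the sign change;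
    and |S y| is at least cos h times the amplitude, because y is within h of a
    zero of the sinusoid. *)
Lemma sum_sinusoid_ge A B N : (0 < N)%N ->
  Num.sqrt (A ^+ 2 + B ^+ 2) * cos (pi / (2 * N)%:R) <=
  sin (pi / (2 * N)%:R) * \sum_(0 <= k < N) `|sinusoid A B (k%:R * (pi / N%:R))|.
Proof.
move=> N0; set h := pi / (2 * N)%:R; set al := pi / N%:R.
have N0' : N%:R != 0 :> R by rewrite pnatr_eq0 -lt0n.
have alE : al = h + h by rewrite /al /h natrM; field.
have h0 : 0 <= h by rewrite divr_ge0 ?pi_ge0.
have h1 : h <= pi / 2.
  by rewrite /h ler_pM2l ?pi_gt0// lef_pV2 ?posrE ?ltr0n ?muln_gt0// ler_nat leq_pmulr.
have pi0 := pi_gt0 R.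
have sh : 0 <= sin h by apply: sin_ge0_pi; lra.
have ch : 0 <= cos h by apply: cos_ge0_pihalf; lra.
have [j jN sgn] := sinusoid_sign_change A B N0.
(* y is the midpoint of the two samples between which the sign changes *)
pose C := sinusoid A B; pose S := sinusoid B (- A).
rewrite -(sinusoid_window A B j.+1 N0) -/al.
pose y := j.+1%:R * al - h.
have tel : 2 * (sin h * \sum_(j.+1 <= k < j.+1 + N) C (k%:R * al)) = 2 * S y.
  rewrite mulrA mulr_sumr.
  under eq_bigr do rewrite sinusoid_telescope -/S.
  transitivity (\sum_(j.+1 <= k < j.+1 + N)
      (- S (k.+1%:R * al - h) - - S (k%:R * al - h))).
    apply: eq_bigr => k _; rewrite opprK addrC; congr (- S _ + S _).
    by rewrite -natr1 alE; ring.
  rewrite telescope_sumr ?leq_addr// opprK natrD mulrDl.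
  have -> : N%:R * al = pi by rewrite /al; field.
  rewrite -/y (_ : _ + pi - h = y + pi); last by rewrite /y; ring.
  by rewrite /S sinusoidDpi; ring.
have {}tel : sin h * \sum_(j.+1 <= k < j.+1 + N) C (k%:R * al) = S y.
  by apply: (mulfI (_ : 2 != 0 :> R)); rewrite ?pnatr_eq0.
apply: (@le_trans _ _ `|S y|); last first.
  rewrite -tel normrM (ger0_norm sh) ler_wpM2l//; exact: ler_norm_sum.
have yE : j.+1%:R * al = y + h by rewrite subrK.
have yE' : j%:R * al = y - h by rewrite /y -natr1 alE; ring.
clearbody y.
have Cp : C (j.+1%:R * al) = C y * cos h - S y * - sin h.
  by rewrite yE /C /S /sinusoid cosD sinD; ring.
have Cm : C (j%:R * al) = C y * cos h - S y * sin h.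
  by rewrite yE' /C /S /sinusoid cosB sinB; ring.
have CS : C y ^+ 2 + S y ^+ 2 = A ^+ 2 + B ^+ 2.
  have := cos2Dsin2 y => c2.
  transitivity ((A ^+ 2 + B ^+ 2) * (cos y ^+ 2 + sin y ^+ 2)); last by rewrite c2 mulr1.
  by rewrite /C /S /sinusoid; ring.
(* the product of the samples at y - h and y + h is nonpositive *)
have key : (A ^+ 2 + B ^+ 2) * cos h ^+ 2 <= S y ^+ 2.
  have c2 := cos2Dsin2 h.
  move: sgn; rewrite -/al -!/(C _) Cm Cp => sgn.
  have e : (A ^+ 2 + B ^+ 2) * cos h ^+ 2 - S y ^+ 2 =
    (C y * cos h - S y * sin h) * (C y * cos h - S y * - sin h).
    rewrite -CS -[S y ^+ 2 in X in _ - X]mulr1 -c2; ring.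
  by rewrite -subr_le0 e.
rewrite -sqrtr_sqr -[X in _ * X]ger0_norm// -sqrtr_sqr -sqrtrM ?addr_ge0 ?sqr_ge0//.
exact: ler_wsqrtr.
Qed.

End Trigonometry.

(** * Euclidean geometry of the plane *)

Section Plane.
Context {R : realType}.
Implicit Types (u v w x y : 'rV[R]_2) (a t : R).

Definition dot u v : R := u 0 0 * v 0 0 + u 0 1 * v 0 1.

Definition cross u v : R := u 0 0 * v 0 1 - u 0 1 * v 0 0.

Lemma eq_rV2 u v : u 0 0 = v 0 0 -> u 0 1 = v 0 1 -> u = v.
Proof.
move=> e0 e1; apply/rowP => i.
have [i0|i1] : i = 0 \/ i = 1; last 2 first.
- by rewrite i0.
- by rewrite i1.
by case: i => [[|[|//]]] ?; [left|right]; apply: val_inj.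
Qed.

Lemma enormE v : enorm v = Num.sqrt (dot v v).
Proof.
rewrite /enorm big_ord_recl big_ord1 /dot -!expr2.
by congr (Num.sqrt (_ + v _ _ ^+ 2)); apply: val_inj.
Qed.

Lemma dot_ge0 v : 0 <= dot v v.
Proof. by rewrite /dot -!expr2 addr_ge0 ?sqr_ge0. Qed.

Lemma dot_eq0 v : dot v v = 0 -> v = 0.
Proof.
rewrite /dot -!expr2 => /eqP; rewrite paddr_eq0 ?sqr_ge0// !sqrf_eq0.
by move=> /andP[/eqP v0 /eqP v1]; apply: eq_rV2; rewrite mxE.
Qed.

Lemma enorm_ge0 v : 0 <= enorm v.
Proof. by rewrite enormE sqrtr_ge0. Qed.

Lemma sqr_enorm v : enorm v ^+ 2 = dot v v.
Proof. by rewrite enormE sqr_sqrtr// dot_ge0. Qed.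

Lemma enorm_eq0 v : enorm v = 0 -> v = 0.
Proof. by move=> v0; apply: dot_eq0; rewrite -sqr_enorm v0 expr0n. Qed.

Lemma enormZ a v : enorm (a *: v) = `|a| * enorm v.
Proof.
rewrite !enormE -sqrtr_sqr -sqrtrM ?sqr_ge0//; congr Num.sqrt.
by rewrite /dot !mxE; ring.
Qed.

Lemma dotDl u v w : dot (u + v) w = dot u w + dot v w.
Proof. by rewrite /dot !mxE; ring. Qed.

Lemma dotBl u v w : dot (u - v) w = dot u w - dot v w.
Proof. by rewrite /dot !mxE; ring. Qed.

Lemma dotZl a v w : dot (a *: v) w = a * dot v w.
Proof. by rewrite /dot !mxE; ring. Qed.

Lemma dot_suml I (s : seq I) (F : I -> 'rV[R]_2) w :
  dot (\sum_(i <- s) F i) w = \sum_(i <- s) dot (F i) w.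
Proof.
apply: (big_morph (fun v => dot v w)); first by move=> u v; exact: dotDl.
by rewrite /dot !mxE; ring.
Qed.

Lemma dot2Dcross2 u v : dot u v ^+ 2 + cross u v ^+ 2 = dot u u * dot v v.
Proof. by rewrite /dot /cross; ring. Qed.

Lemma dot_le_enorm v u : dot u u = 1 -> dot v u <= enorm v.
Proof.
move=> u1; apply: le_trans (ler_norm _) _.
rewrite enormE -sqrtr_sqr ler_wsqrtr//.
by rewrite -[leRHS]mulr1 -u1 -dot2Dcross2 lerDl sqr_ge0.
Qed.

Lemma dot_cross_inj u v w : dot u u = 1 ->
  dot v u = dot w u -> cross v u = cross w u -> v = w.
Proof.
move=> u1 d c; apply/eqP; rewrite -subr_eq0; apply/eqP/dot_eq0.
rewrite -[LHS]mulr1 -u1 -dot2Dcross2 dotBl d subrr.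
have -> : cross (v - w) u = cross v u - cross w u by rewrite /cross !mxE; ring.
by rewrite c subrr expr0n addr0.
Qed.

Lemma continuous_dot u : continuous (dot^~ u).
Proof.
move=> x; have co i : (fun y : 'rV[R]_2 => y 0 i) @ x --> x 0 i by exact: coord_continuous.
exact: (cvgD (cvgM (co 0) (cvg_cst (u 0 0))) (cvgM (co 1) (cvg_cst (u 0 1)))).
Qed.

Lemma continuous_cross u : continuous (cross^~ u).
Proof.
move=> x; have co i : (fun y : 'rV[R]_2 => y 0 i) @ x --> x 0 i by exact: coord_continuous.
exact: (cvgB (cvgM (co 0) (cvg_cst (u 0 1))) (cvgM (co 1) (cvg_cst (u 0 0)))).
Qed.

Lemma continuous_enormB u : continuous (fun x => enorm (x - u)).
Proof.
move=> x; rewrite (_ : (fun y => _) = Num.sqrt \o (fun y => dot (y - u) (y - u))); last first.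
  by apply/funext => y; rewrite enormE.
apply: continuous_comp; last exact: sqrt_continuous.
have co i : (fun y : 'rV[R]_2 => (y - u) 0 i) @ x --> (x - u) 0 i.
  rewrite (_ : (fun y : 'rV[R]_2 => (y - u) 0 i) = (fun y : 'rV[R]_2 => y 0 i - u 0 i)); last first.
    by apply/funext => y; rewrite !mxE.
  have cx : (fun y : 'rV[R]_2 => y 0 i) @ x --> x 0 i by exact: coord_continuous.
  by rewrite !mxE; exact: (cvgB cx (cvg_cst (u 0 i))).
exact: (cvgD (cvgM (co 0) (co 0)) (cvgM (co 1) (co 1))).
Qed.

Definition rot a : 'M[R]_2 := \matrix_(i, j)
  if i == j then cos a else if i == 0 then sin a else - sin a.

Lemma mulmx_rot v a :
  v *m rot a = \row_j (if j == 0 then v 0 0 * cos a - v 0 1 * sin a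
                       else v 0 0 * sin a + v 0 1 * cos a).
Proof.
apply: eq_rV2; rewrite !mxE big_ord_recl big_ord1 !mxE/=;
  by rewrite (_ : lift ord0 ord0 = 1) /=; [ring|exact: val_inj].
Qed.

Lemma rotation_rot a : rotation (rot a).
Proof.
have c2 := cos2Dsin2 a; have l1 : lift ord0 ord0 = 1 :> 'I_2 by exact: val_inj.
split.
  apply/matrixP => i j; rewrite !mxE big_ord_recl big_ord1 !mxE/= l1.
  case: i => [[|[|//]]] ?; case: j => [[|[|//]]] ?;
    rewrite -!val_eqE /= ?mulr1n ?mulr0n -?c2; ring.
rewrite (expand_det_row _ 0) big_ord_recl big_ord1 /cofactor !det_mx11.
by rewrite !mxE/= /bump/= addn0 expr0 expr1 -[RHS]c2; ring.
Qed.

(** This identity is what turns sums over rotated vectors into sums of samples of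
    a sinusoid, of amplitude |v| |u| by [dot2Dcross2]. *)
Lemma dot_mulmx_rot v u a :
  dot (v *m rot a) u = sinusoid (dot v u) (cross v u) a.
Proof. by rewrite mulmx_rot /sinusoid /dot /cross !mxE/=; ring. Qed.

Lemma sum_dot_rot_ge v u N : (0 < N)%N -> dot u u = 1 ->
  enorm v * cos (pi / (2 * N)%:R) <=
  sin (pi / (2 * N)%:R) *
    \sum_(0 <= k < N) `|dot (v *m rot (k%:R * (pi / N%:R))) u|.
Proof.
move=> N0 u1; have vE : dot v v = dot v u ^+ 2 + cross v u ^+ 2.
  by rewrite dot2Dcross2 u1 mulr1.
rewrite enormE vE.
under eq_bigr do rewrite dot_mulmx_rot.
exact: sum_sinusoid_ge.
Qed.

End Plane.

(** * Means and separation in convex sets *)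

Section Convexity.
Context {R : realType}.
Implicit Types (A : set 'rV[R]_2) (x y u : 'rV[R]_2) (t : R).

Lemma convex_set_mix A x y t : @convex_set R 'rV[R]_2 A -> 0 <= t -> t <= 1 ->
  A x -> A y -> A (t *: x + (1 - t) *: y).
Proof.
move=> cA t0 t1 Ax Ay.
have := cA x y (Itv01 t0 t1); rewrite !inE => /(_ Ax Ay).
by [].
Qed.

Lemma convex_set_mean A (F : nat -> 'rV[R]_2) n : @convex_set R 'rV[R]_2 A ->
  (forall k, A (F k)) -> A (n.+1%:R^-1 *: \sum_(0 <= k < n.+1) F k).
Proof.
move=> cA AF; elim: n => [|n IHn]; first by rewrite invr1 scale1r big_nat1.
rewrite big_nat_recr//= scalerDr.
have -> : n.+2%:R^-1 *: \sum_(0 <= k < n.+1) F k =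
   (1 - n.+2%:R^-1) *: (n.+1%:R^-1 *: \sum_(0 <= k < n.+1) F k).
  rewrite scalerA; congr (_ *: _).
  by rewrite -[n.+2%:R]natr1; field; rewrite nat1r natr1 !pnatr_eq0.
rewrite addrC; apply: convex_set_mix => //.
by rewrite invf_le1 ?ltr0n// ler1n.
Qed.

(** The direction from the point q of A nearest to x towards x separates: the
    segment from q to any y in A does not get closer to x than q, so that it
    leaves q at an angle of at least pi / 2 from x - q. *)
Lemma convex_shape_separation A x : convex_shape A -> ~ A x ->
  exists2 u, dot u u = 1 & forall y, A y -> dot y u < dot x u.
Proof.
move=> [A0 cptA cA] Ax.
have [q Aq qmin] := EVT_min_rV A0 cptA (continuous_subspaceT (@continuous_enormB _ x)).
rewrite inE in Aq.
have obtuse y : A y -> 0 <= dot (y - q) (q - x).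
  move=> Ay; rewrite leNgt; apply/negP => lt0.
  set a := dot (y - q) (q - x) in lt0; set b := dot (y - q) (y - q).
  have b0 : 0 <= b := dot_ge0 _.
  (* moving from q by t towards y changes the squared distance to x by
     t (2 a + t b), which is negative for this t *)
  have ba : 0 < b - a by lra.
  pose t := - a / (b - a).
  have t0 : 0 < t by rewrite divr_gt0// oppr_gt0.
  have t1 : t <= 1 by rewrite ler_pdivrMr// mul1r; lra.
  have /qmin : (t *: y + (1 - t) *: q) \in A.
    by rewrite inE; apply: convex_set_mix => //; exact: ltW.
  rewrite -ler_sqr ?nnegrE ?enorm_ge0// !sqr_enorm.
  have -> : dot (t *: y + (1 - t) *: q - x) (t *: y + (1 - t) *: q - x) =
     dot (q - x) (q - x) + t * (2 * a + t * b).
    by rewrite /a /b /dot !mxE; ring.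
  rewrite lerDl pmulr_rge0// leNgt => /negP; apply.
  have tba : t * (b - a) = - a by rewrite mulfVK// gt_eqF.
  have : t * a <= 0 by rewrite pmulr_rle0// ltW.
  by move: tba; rewrite mulrBr; lra.
have xq : 0 < enorm (x - q).
  rewrite lt_def enorm_ge0 andbT; apply/eqP => /enorm_eq0/eqP.
  by rewrite subr_eq0 => /eqP xq; apply: Ax; rewrite xq.
exists ((enorm (x - q))^-1 *: (x - q)).
  have := sqr_enorm ((enorm (x - q))^-1 *: (x - q)).
  by rewrite enormZ ger0_norm ?invr_ge0 ?enorm_ge0// mulVf ?gt_eqF// expr1n.
move=> y Ay; rewrite -subr_gt0 -dotBl.
have -> : dot (x - y) ((enorm (x - q))^-1 *: (x - q)) =
   (enorm (x - q))^-1 * (dot (x - q) (x - q) + dot (y - q) (q - x)).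
  by rewrite /dot !mxE; ring.
rewrite mulr_gt0 ?invr_gt0//.
by rewrite ltr_pwDl ?obtuse// -sqr_enorm exprn_gt0.
Qed.

End Convexity.

(** * The mean of the rotated copies of P *)

Section RotationMean.
Context {R : realType}.
Implicit Types (P Q : set 'rV[R]_2) (u v : 'rV[R]_2) (vs : seq 'rV[R]_2).

Lemma dot_rot_adj v u (a : R) : dot (v *m rot a) u = dot v (u *m rot (- a)).
Proof. by rewrite !mulmx_rot cosN sinN /dot !mxE/=; ring. Qed.

Lemma dot_rot_iso u (a : R) : dot (u *m rot a) (u *m rot a) = dot u u.
Proof.
rewrite -[RHS]mulr1 -(cos2Dsin2 a) !mulmx_rot /dot !mxE/=; ring.
Qed.

Lemma rotDpi (a : R) : rot (a + pi) = - rot a.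
Proof.
by apply/matrixP => i j; rewrite !mxE cosDpi sinDpi; case: ifP => // _; case: ifP.
Qed.

(** For points p and q of P, dot p u - dot q u is at most the width of P in the
    direction u.  Asking for witnesses avoids suprema, and they are the points
    that get averaged in [placeable_disk]. *)
Definition width_bounds vs P : Prop := forall u, dot u u = 1 ->
  exists p q, [/\ P p, P q &
    \sum_(v <- vs) `|dot v u| <= 2 * (dot p u - dot q u)].

(** The centre is the mean of the translations used for the 2N rotations.  If a
    point x of the disk were outside Q, a line orthogonal to some unit vector u
    would separate it from Q.  Choose, in each pair of opposite copies of P,
    the images of the two points which bound the width in the direction u, as
    seen in the rotated frame.  The mean of the 2N chosen points is in Q, and
    by [sum_dot_rot_ge] it lies at least as far as x in the direction u. *)
Lemma placeable_disk P Q vs N r : convex_shape Q ->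
  placeable_in_every_orientation P Q -> width_bounds vs P -> (0 < N)%N ->
  (4 * N)%:R * r * sin (pi / (2 * N)%:R) <=
    (\sum_(v <- vs) enorm v) * cos (pi / (2 * N)%:R) ->
  exists c, closed_disk c r `<=` Q.
Proof.
move=> cQ PQ wvs N0; set h := pi / _ => rN.
have sh : 0 < sin h.
  apply: sin_gt0_pi; rewrite divr_gt0 ?pi_gt0 ?ltr0n ?muln_gt0//=.
  by rewrite ltr_pdivrMr ?ltr0n ?muln_gt0// ltr_pMr ?pi_gt0// ltr1n leq_pmulr.
pose M k : 'M[R]_2 := rot (k%:R * (pi / N%:R)).
have /choice[t tQ] k : exists t, [set x *m M k + t | x in P] `<=` Q.
  exact/PQ/rotation_rot.
have /choice[t' t'Q] k : exists t, [set x *m - M k + t | x in P] `<=` Q.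
  by apply: PQ; rewrite /M -rotDpi; exact: rotation_rot.
pose s k := 2^-1 *: (t k + t' k).
exists (N%:R^-1 *: \sum_(0 <= k < N) s k) => x; set c := _ *: _.
rewrite /closed_disk/= => xr; apply: contrapT => /(convex_shape_separation cQ)[u u1 usep].
have /choice[y yP] k : exists y, Q y /\
    4^-1 * \sum_(v <- vs) `|dot (v *m M k) u| + dot (s k) u <= dot y u.
  (* u seen in the frame of P before the rotation M k *)
  have u1' : dot (u *m rot (- (k%:R * (pi / N%:R)))) (u *m rot (- (k%:R * (pi / N%:R)))) = 1.
    by rewrite dot_rot_iso.
  have [p [q [Pp Pq]]] := wvs _ u1'.
  rewrite -!dot_rot_adj -/(M k).
  under eq_bigr do rewrite -dot_rot_adj -/(M k).
  move=> le.
  exists (2^-1 *: (p *m M k + t k) + (1 - 2^-1) *: (q *m - M k + t' k)); split.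
    have [_ _ /convex_set_mix] := cQ; apply; first by rewrite invr_ge0.
    - by rewrite invf_le1// ler1n.
    - by apply: tQ; exists p.
    - by apply: t'Q; exists q.
  rewrite mulmxN /s !(dotDl, dotZl).
  have -> : dot (- (q *m M k)) u = - dot (q *m M k) u by rewrite /dot !mxE; ring.
  lra.
have Qmean : Q (N%:R^-1 *: \sum_(0 <= k < N) y k).
  have [_ _ cQ'] := cQ; rewrite -(ltn_predK N0).
  by apply: convex_set_mean => // k; have [] := yP k.
have := usep _ Qmean; rewrite ltNge => /negP; apply.
have -> : dot x u = dot c u + dot (x - c) u by rewrite dotBl; ring.
apply: (@le_trans _ _ (dot c u + r)).
  by rewrite lerD2l (le_trans (dot_le_enorm _ u1)).
apply: (@le_trans _ _ (N%:R^-1 *: \sum_(0 <= k < N)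
    (4^-1 * (\sum_(v <- vs) `|dot (v *m M k) u|) + dot (s k) u))); last first.
  rewrite dotZl dot_suml ler_wpM2l ?invr_ge0//.
  by apply: ler_sum => k _; have [] := yP k.
rewrite big_split/= scalerDr addrC /c dotZl dot_suml lerD2r -mulr_sumr exchange_big/=.
have N0' : 0 < N%:R :> R by rewrite ltr0n.
rewrite [leRHS]mulrC ler_pdivlMr// ler_pdivlMl//.
rewrite -(ler_pM2r sh).
apply: le_trans (_ : _ <= (\sum_(v <- vs) enorm v) * cos h) _.
  rewrite (le_trans _ rN)// natrM.
  by rewrite (_ : _ * sin h = 4 * N%:R * r * sin h)//; ring.
rewrite !mulr_suml ler_sum// => v _.
by rewrite mulrC [leRHS]mulrC mulrC; exact: sum_dot_rot_ge.
Qed.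

Lemma width_bounds_le P Q vs N r : convex_shape Q ->
  placeable_in_every_orientation P Q -> width_bounds vs P -> (0 < N)%N ->
  (forall c r', 0 <= r' -> closed_disk c r' `<=` Q -> r' <= r) ->
  (\sum_(v <- vs) enorm v) * cos (pi / (2 * N)%:R) <=
    (4 * N)%:R * r * sin (pi / (2 * N)%:R).
Proof.
move=> cQ PQ wvs N0 rmax; set h := pi / _; set L := _ * cos h.
have h0 : 0 < h by rewrite divr_gt0 ?pi_gt0 ?ltr0n ?muln_gt0.
have h1 : h <= pi / 2.
  by rewrite /h ler_pM2l ?pi_gt0// lef_pV2 ?posrE ?ltr0n ?muln_gt0// ler_nat leq_pmulr.
have pi0 := pi_gt0 R.
have sh : 0 < sin h by apply: sin_gt0_pi; lra.
have ch : 0 <= cos h by apply: cos_ge0_pihalf; lra.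
have N4 : 0 < (4 * N)%:R :> R by rewrite ltr0n muln_gt0.
have L0 : 0 <= L by rewrite mulr_ge0// sumr_ge0// => v _; exact: enorm_ge0.
pose rho := L / ((4 * N)%:R * sin h).
have rhoE : (4 * N)%:R * rho * sin h = L.
  by rewrite mulrAC /rho mulrC divfK// gt_eqF// mulr_gt0.
have rho0 : 0 <= rho by rewrite divr_ge0// mulr_ge0// ltW.
have [|c cQr] := @placeable_disk P Q vs N rho cQ PQ wvs N0; first by rewrite rhoE.
by rewrite -rhoE ler_pM2r// ler_pM2l//; exact: rmax cQr.
Qed.

End RotationMean.

(** * Lines through a convex set *)

Section BoundaryLines.
Context {R : realType}.
Implicit Types (A : set 'rV[R]_2) (a b d p q u x : 'rV[R]_2).

(** G and T are the barycentric coordinates of x with respect to d and q in the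
    triangle a d q.  At a point in the relative interior of the edge a d, G and
    1 - G - T are positive, and they stay so nearby; hence a nearby x is in the
    triangle as soon as T is nonnegative, that is, as soon as x is on the same
    side of the edge as q. *)
Lemma near_triangle_edge A a d q (s : R) : @convex_set R 'rV[R]_2 A ->
  A a -> A d -> A q -> cross (d - a) (q - a) != 0 -> 0 < s < 1 ->
  \forall x \near a + s *: (d - a),
    0 <= cross (d - a) (x - a) / cross (d - a) (q - a) -> A x.
Proof.
move=> cA Aa Ad Aq; set D := cross (d - a) (q - a) => D0 /andP[s0 s1].
set b := a + s *: (d - a).
pose G x := (cross x (q - a) - cross a (q - a)) / D.
pose T x := (cross a (d - a) - cross x (d - a)) / D.
have Gb : G b = s.
  apply: (mulIf D0); rewrite /G mulfVK// /D /b /cross !mxE; ring.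
have Tb : T b = 0.
  by apply: (mulIf D0); rewrite /T mulfVK// /D /b /cross !mxE; ring.
have cc w : cross x w @[x --> b] --> cross b w by exact: continuous_cross.
have cG : G x @[x --> b] --> s.
  rewrite -Gb.
  exact: (cvgM (cvgB (cc _) (cvg_cst (cross a (q - a)))) (cvg_cst D^-1)).
have cT : T x @[x --> b] --> (0 : R).
  rewrite -Tb.
  exact: (cvgM (cvgB (cvg_cst (cross a (d - a))) (cc _)) (cvg_cst D^-1)).
have cGT : G x + T x @[x --> b] --> s by rewrite -[X in _ --> X]addr0; exact: (cvgD cG cT).
have G0 : \forall x \near b, 0 < G x by exact: (cvgr_gt _ cG).
have GT1 : \forall x \near b, G x + T x < 1 by exact: (cvgr_lt _ cGT).
near=> x => T0.
have TE : cross (d - a) (x - a) / D = T x.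
  by rewrite /T /cross !mxE; congr (_ / _); ring.
rewrite TE in T0.
have Gx : 0 < G x by near: x.
have GTx : G x + T x < 1 by near: x.
have T1 : 0 < 1 - T x by lra.
have -> : x = T x *: q + (1 - T x) *:
    (G x / (1 - T x) *: d + (1 - G x / (1 - T x)) *: a).
  have T1' : 1 - T x != 0 by rewrite gt_eqF.
  apply/rowP => i; rewrite !mxE.
  have -> : T x * q 0 i + (1 - T x) *
      (G x / (1 - T x) * d 0 i + (1 - G x / (1 - T x)) * a 0 i)
    = a 0 i + G x * (d 0 i - a 0 i) + T x * (q 0 i - a 0 i) by field.
  apply: (mulIf D0); rewrite !mulrDl.
  rewrite (mulrAC (G x)) (mulrAC (T x)) /G /T !mulfVK//.
  suff H : forall j, j = 0 \/ j = 1 -> x 0 j * D = a 0 j * D +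
      (cross x (q - a) - cross a (q - a)) * (d 0 j - a 0 j) +
      (cross a (d - a) - cross x (d - a)) * (q 0 j - a 0 j).
    apply: H.
    by case: i => [[|[|//]]] ?; [left|right]; apply: val_inj.
  by move=> j [|] ->; rewrite /D /cross !mxE; ring.
apply: convex_set_mix => //; first by lra.
apply: convex_set_mix => //; first by rewrite divr_ge0// ltW.
by rewrite ler_pdivrMr// mul1r; lra.
Unshelve. all: by end_near. Qed.

(** The triangles a d p and a d q are on both sides of the edge a d, and together
    they contain a neighborhood of b. *)
Lemma interior_between A a b d p q u : @convex_set R 'rV[R]_2 A -> dot u u = 1 ->
  A a -> A d -> A p -> A q ->
  dot a u = dot b u -> dot d u = dot b u ->
  cross a u < cross b u -> cross b u < cross d u ->
  dot p u < dot b u -> dot b u < dot q u -> interior A b.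
Proof.
move=> cA u1 Aa Ad Ap Aq ab db cab cbd pb bq.
pose s := (cross b u - cross a u) / (cross d u - cross a u).
have da0 : 0 < cross d u - cross a u by lra.
have s01 : 0 < s < 1.
  by rewrite /s divr_gt0 ?subr_gt0//= ?ltr_pdivrMr ?mul1r ?subr_gt0//; lra.
have bE : b = a + s *: (d - a).
  apply: (dot_cross_inj u1).
    have -> : dot (a + s *: (d - a)) u = dot a u + s * (dot d u - dot a u).
      by rewrite /dot !mxE; ring.
    by rewrite db ab subrr mulr0 addr0.
  have -> : cross (a + s *: (d - a)) u = cross a u + s * (cross d u - cross a u).
    by rewrite /cross !mxE; ring.
  by rewrite /s mulfVK ?gt_eqF//; ring.
(* d - a is orthogonal to u, so the area form against it only sees dot _ u *)
have crossE w : cross (d - a) (w - a) = (cross d u - cross a u) * (dot w u - dot b u).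
  rewrite -ab.
  have -> : cross (d - a) (w - a) = dot u u * cross (d - a) (w - a) by rewrite u1 mul1r.
  transitivity ((cross d u - cross a u) * (dot w u - dot a u) -
    (dot d u - dot a u) * (cross w u - cross a u)).
    by rewrite /dot /cross !mxE; ring.
  by rewrite db ab subrr mul0r subr0.
have cq : 0 < cross (d - a) (q - a) by rewrite crossE mulr_gt0// subr_gt0.
have cp : cross (d - a) (p - a) < 0 by rewrite crossE pmulr_rlt0// subr_lt0.
have nq := near_triangle_edge cA Aa Ad Aq (lt0r_neq0 cq) s01.
have np := near_triangle_edge cA Aa Ad Ap (ltr0_neq0 cp) s01.
rewrite /interior/= bE.
near=> x.
have [c0|c0] := leP 0 (cross (d - a) (x - a)).
  have : 0 <= cross (d - a) (x - a) / cross (d - a) (q - a); last by near: x.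
  by rewrite divr_ge0// ltW.
have : 0 <= cross (d - a) (x - a) / cross (d - a) (p - a); last by near: x.
by rewrite -mulrNN -invrN divr_ge0// oppr_ge0 ltW.
Unshelve. all: by end_near. Qed.

(** Of three distinct points on a line, one is between the two others, and
    [interior_between] puts it in the interior. *)
Lemma line_meets_boundary_twice A p q u x1 x2 x3 : @convex_set R 'rV[R]_2 A ->
  closed A -> dot u u = 1 -> A p -> A q ->
  boundary A x1 -> boundary A x2 -> boundary A x3 ->
  dot x1 u = dot x2 u -> dot x3 u = dot x2 u ->
  dot p u < dot x2 u -> dot x2 u < dot q u ->
  [\/ x1 = x2, x2 = x3 | x1 = x3].
Proof.
move=> cA clA u1 Ap Aq; rewrite /boundary -(closure_id A).1//.
move=> [A1 n1] [A2 n2] [A3 n3] e1 e3 px xq.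
have inj x y : dot x u = dot x2 u -> dot y u = dot x2 u -> cross x u = cross y u -> x = y.
  by move=> ex ey; apply: (dot_cross_inj u1); rewrite ex ey.
have no x y z : A x -> A z -> dot x u = dot x2 u -> dot y u = dot x2 u ->
    dot z u = dot x2 u -> ~ interior A y -> cross x u < cross y u ->
    cross y u < cross z u -> False.
  move=> Ax Az ex ey ez ny xy yz; apply: ny.
  by apply: (interior_between cA u1 Ax Az Ap Aq); rewrite ?ex ?ey ?ez.
case: (ltgtP (cross x1 u) (cross x2 u)) => [c12|c12|/inj->//]; last by constructor 1.
- case: (ltgtP (cross x2 u) (cross x3 u)) => [c23|c23|/inj->//]; last by constructor 2.
    by have := no _ _ _ A1 A3 e1 erefl e3 n2 c12 c23.
  case: (ltgtP (cross x1 u) (cross x3 u)) => [c13|c13|/inj->//]; last by constructor 3.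
    by have := no _ _ _ A1 A2 e1 e3 erefl n3 c13 c23.
  by have := no _ _ _ A3 A2 e3 e1 erefl n1 c13 c12.
- case: (ltgtP (cross x2 u) (cross x3 u)) => [c23|c23|/inj->//]; last by constructor 2.
    case: (ltgtP (cross x1 u) (cross x3 u)) => [c13|c13|/inj->//]; last by constructor 3.
      by have := no _ _ _ A2 A3 erefl e1 e3 n1 c12 c13.
    by have := no _ _ _ A2 A1 erefl e3 e1 n3 c23 c13.
  by have := no _ _ _ A3 A1 e3 erefl e1 n2 c23 c12.
Qed.

End BoundaryLines.

(** * Variation of functions with at most two preimages *)

Section Variation.
Context {R : realType}.
Implicit Types (f : R -> R) (c m M : R) (s : seq R).

(** Integrate over [m, M] the number of intervals ]l i, r i[ that contain c: the
    integral is the sum of the lengths, and the integrand is at most 2. *)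
Lemma sum_length_cover2 (n : nat) (l r : nat -> R) m M :
  (forall i, (i < n)%N -> [/\ m <= l i, l i <= r i & r i <= M]) ->
  (forall c i j k, (i < j)%N -> (j < k)%N -> (k < n)%N ->
     l i < c < r i -> l j < c < r j -> l k < c < r k -> False) ->
  m <= M ->
  \sum_(0 <= i < n) (r i - l i) <= 2 * (M - m).
Proof.
move=> lr no3 mM.
pose I i : set R := `]l i, r i[%classic.
pose mu : {measure set (measurableTypeR R) -> \bar R} := @lebesgue_measure R.
have mI i : measurable (I i) by exact: measurable_itv.
have mD : measurable `[m, M]%classic by exact: measurable_itv.
have muI i : (i < n)%N -> (\int[mu]_(x in `[m, M]) (\1_(I i) x)%:E = (r i - l i)%:E)%E.
  move=> /lr[ml lri rM]; rewrite integral_indic//; last exact: mI.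
  rewrite setIidl; last first.
    move=> x; rewrite /I /= !in_itv/= => /andP[lx xr].
    by rewrite (le_trans ml (ltW lx)) (le_trans (ltW xr) rM).
  apply: (etrans (lebesgue_measure_itv `]l i, r i[)) => /=.
  rewrite lte_fin; case: ltgtP lri => // -> _.
  by rewrite subrr.
have count2 c : (\sum_(0 <= i < n) \1_(I i) c <= 2 :> R).
  have -> : \sum_(0 <= i < n) \1_(I i) c =
      (size [seq i <- index_iota 0 n | c \in I i])%:R :> R.
    rewrite size_filter -sum1_count [in RHS]big_mkcond natr_sum.
    by apply: eq_bigr => ? _; rewrite indicE; case: (c \in _).
  rewrite ler_nat leqNgt; apply/negP.
  set t := [seq _ <- _ | _] => t3.
  have : sorted ltn t by apply: sorted_filter; [exact: ltn_trans|exact: iota_ltn_sorted].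
  have tP i : i \in t -> (i < n)%N /\ l i < c < r i.
    rewrite mem_filter mem_index_iota => /andP[ci /andP[_ iN]]; split=> //.
    by move: ci; rewrite inE /I /= in_itv.
  case: t t3 tP => [//|i [//|j [//|k t]]] _ tP /= /and3P[ij jk _].
  have [|_ ci] := tP i; first by rewrite !inE eqxx.
  have [|_ cj] := tP j; first by rewrite !inE eqxx ?orbT.
  have [|kn ck] := tP k; first by rewrite !inE eqxx ?orbT.
  exact: (no3 c i j k).
rewrite -lee_fin -sumEFin.
rewrite (eq_big_nat _ _
  (F2 := fun i => (\int[mu]_(x in `[m, M]) (\1_(I i) x)%:E)%E)); last first.
  by move=> i /andP[_ iN]; rewrite muI.
rewrite -ge0_integral_sum//; last first.
  by move=> i; apply/measurable_EFinP; apply: measurable_indic; exact: mI.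
apply: (@le_trans _ _ (\int[mu]_(x in `[m, M]) (cst 2%:E x))%E).
  apply: ge0_le_integral => //.
  - by move=> x _; apply: sume_ge0 => i _; rewrite lee_fin.
  - by apply: emeasurable_sum => i; apply/measurable_EFinP; apply: measurable_indic; exact: mI.
  - by move=> x _; rewrite sumEFin lee_fin; exact: count2.
rewrite integral_cst//.
have -> : mu `[m, M]%classic = (M - m)%:E.
  apply: (etrans (lebesgue_measure_itv `[m, M])) => /=.
  by rewrite lte_fin; case: ltgtP mM => // -> _; rewrite subrr.
by rewrite -EFinM.
Qed.

Lemma itv_partition_nth_lt (a b : R) s i : itv_partition a b s ->
  (i < size s)%N -> nth b (a :: s) i < nth b (a :: s) i.+1.
Proof.
move=> [/(pathP b) ps _]; exact: ps.
Qed.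

(** This is Banach's indicatrix for a finite partition.  By the intermediate value
    theorem, a value c strictly between f (t i) and f (t i.+1) is taken strictly
    between t i and t i.+1.  Distinct i give distinct preimages of c, so that no
    c is in three of these open intervals of values. *)
Lemma variation_le_two_preimages f s m M :
  {within `[0, 1]%classic, continuous f} -> itv_partition 0 1 s -> m <= M ->
  (forall t, 0 <= t <= 1 -> m <= f t <= M) ->
  (forall c t1 t2 t3, m < c < M -> 0 < t1 -> t1 < t2 -> t2 < t3 -> t3 < 1 ->
     f t1 = c -> f t2 = c -> f t3 = c -> False) ->
  \sum_(0 <= i < size s) `|f (nth 1 (0 :: s) i.+1) - f (nth 1 (0 :: s) i)|
    <= 2 * (M - m).
Proof.
move=> cf ps mM fb no3; set t := nth 1 (0 :: s).
have t01 i : 0 <= t i <= 1.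
  have [lis|lis] := ltnP i (size s).+1.
    by rewrite (itv_partition_nth_ge lis ps) (itv_partition_nth_le lis ps).
  by rewrite /t nth_default// ler01 lexx.
have tlt i : (i < size s)%N -> t i < t i.+1 by exact: itv_partition_nth_lt.
have tle i j : (i <= j)%N -> (j <= size s)%N -> t i <= t j.
  elim: j => [|j IHj]; first by rewrite leqn0 => /eqP->.
  rewrite leq_eqVlt => /predU1P[->//|ij] js.
  by rewrite (le_trans (IHj _ (ltnW js)))// ltW// tlt.
pose l i := Num.min (f (t i)) (f (t i.+1)); pose r i := Num.max (f (t i)) (f (t i.+1)).
have crossing c i : (i < size s)%N -> l i < c < r i ->
    exists2 z, t i < z < t i.+1 & f z = c.
  move=> lis /andP[lc cr].
  have [||z] := @IVT R f (t i) (t i.+1) c (ltW (tlt _ lis)).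
  - apply: continuous_subspaceW cf => z; rewrite /= !in_itv/= => /andP[iz zi].
    have /andP[i0 _] := t01 i; have /andP[_ i1] := t01 i.+1.
    by rewrite (le_trans i0)// (le_trans zi).
  - by rewrite !ltW.
  rewrite in_itv/= => /andP[iz zi] fz; exists z => //.
  rewrite !lt_neqAle iz zi !andbT; apply/andP; split; apply/eqP => e;
    move: lc cr; rewrite /l /r gt_min lt_max -fz e;
    by rewrite !ltxx ?orbF /= => h1 /(lt_trans h1); rewrite ltxx.
apply: le_trans (sum_length_cover2 (n := size s) (l := l) (r := r) _ _ mM).
- apply: ler_sum => i _; rewrite /l /r.
  by case: (leP (f (t i)) (f (t i.+1))) => h;
    [rewrite ger0_norm ?subr_ge0|rewrite ltr0_norm ?subr_lt0// opprB].
- move=> i lis; have /andP[a1 a2] := fb _ (t01 i); have /andP[b1 b2] := fb _ (t01 i.+1).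
  by rewrite /l /r le_min ge_max a1 a2 b1 b2; split => //; rewrite ge_min le_max lexx.
move=> c i j k ij jk ks ci cj ck.
have js := ltn_trans jk ks; have lis := ltn_trans ij js.
have [x /andP[ix xi] fx] := crossing _ _ lis ci.
have [y /andP[jy yj] fy] := crossing _ _ js cj.
have [z /andP[kz zk] fz] := crossing _ _ ks ck.
apply: (no3 c x y z) => //.
- have /andP[a1 a2] := fb _ (t01 i); have /andP[b1 b2] := fb _ (t01 i.+1).
  move: ci; rewrite /l /r gt_min lt_max => /andP[/orP h1 /orP h2].
  by apply/andP; split; [case: h1|case: h2] => ?; lra.
- by apply: le_lt_trans ix; have /andP[] := t01 i.
- by rewrite (lt_le_trans xi)// (le_trans _ (ltW jy))// tle// ltnW.
- by rewrite (lt_le_trans yj)// (le_trans _ (ltW kz))// tle// ltnW.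
- by apply: lt_le_trans zk _; have /andP[] := t01 k.+1.
Qed.

End Variation.

(** * Chains inscribed in the boundary of a convex shape *)

Section BoundaryChains.
Context {R : realType}.
Implicit Types (P : set 'rV[R]_2) (gamma : R -> 'rV[R]_2) (s : seq R).

Definition chain_edges gamma s : seq 'rV[R]_2 :=
  [seq gamma (nth 1 (0 :: s) i.+1) - gamma (nth 1 (0 :: s) i)
     | i <- index_iota 0 (size s)].

Lemma chain_lengthE gamma s :
  chain_length gamma 0 1 s = \sum_(v <- chain_edges gamma s) enorm v.
Proof. by rewrite /chain_length /chain_edges big_map. Qed.

Lemma compact_dot_extrema P u : P !=set0 -> compact P ->
  exists p q, [/\ P p, P q & forall x, P x -> dot q u <= dot x u <= dot p u].
Proof.
move=> P0 cP; have cu := continuous_subspaceT (A := P) (@continuous_dot R u).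
have [p] := EVT_max_rV P0 cP cu; rewrite inE => Pp pmax.
have [q] := EVT_min_rV P0 cP cu; rewrite inE => Pq qmin.
exists p, q; split => // x Px.
by rewrite qmin ?inE// pmax ?inE.
Qed.

Lemma boundary_chain_width_bounds P gamma s : convex_shape P ->
  simple_closed_parametrization (boundary P) gamma -> itv_partition 0 1 s ->
  width_bounds (chain_edges gamma s) P.
Proof.
move=> [P0 cP cvP] [cg _ ginj gim] ps u u1.
have clP : closed P by apply: compact_closed cP; exact: norm_hausdorff.
have [p [q [Pp Pq ext]]] := compact_dot_extrema u P0 cP.
exists p, q; split => //.
have gB t : 0 <= t <= 1 -> boundary P (gamma t).
  by move=> t01; rewrite -gim; exists t => //=; rewrite in_itv.
have gP t : 0 <= t <= 1 -> P (gamma t).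
  by move=> /gB []; rewrite -(closure_id P).1.
rewrite big_map.
under eq_bigr do rewrite dotBl.
apply: (@variation_le_two_preimages R (fun t => dot (gamma t) u)) => //.
- apply: (@within_continuous_comp _ _ _ _ gamma (dot^~ u)) => //.
  by move=> x _; exact: continuous_dot.
- by have /andP[] := ext _ Pp.
- by move=> t /gP/ext.
move=> c t1 t2 t3 /andP[qc cp] t1_0 t12 t23 t3_1 e1 e2 e3.
have i1 : 0 <= t1 < 1 by lra.
have i2 : 0 <= t2 < 1 by lra.
have i3 : 0 <= t3 < 1 by lra.
have tinj a b : 0 <= a < 1 -> 0 <= b < 1 -> gamma a = gamma b -> a = b.
  by move=> a01 b01; apply: ginj; rewrite inE /= in_itv.
have gB' t : 0 <= t < 1 -> boundary P (gamma t).
  by move=> /andP[t0 t1']; apply: gB; rewrite t0 ltW.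
have [] := line_meets_boundary_twice cvP clP u1 Pq Pp (gB' _ i1) (gB' _ i2)
  (gB' _ i3) _ _ _ _; rewrite ?e1 ?e2 ?e3// => /tinj e.
- by move: t12; rewrite e ?ltxx.
- by move: t23; rewrite e ?ltxx.
- by move: (lt_trans t12 t23); rewrite e ?ltxx.
Qed.

(** The edge is repeated because the perimeter of a segment is twice its length:
    the chain goes along the segment and comes back. *)
Lemma segment_width_bounds (a b : 'rV[R]_2) :
  width_bounds [:: b - a; b - a] (segment a b).
Proof.
have Sa : segment a b a.
  by exists 0 => /=; [rewrite in_itv/= lexx ler01|rewrite subr0 scale1r scale0r addr0].
have Sb : segment a b b.
  by exists 1 => /=; [rewrite in_itv/= lexx ler01|rewrite subrr scale1r scale0r add0r].
move=> u _; rewrite !big_cons big_nil addr0 dotBl.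
have [h|h] := leP (dot a u) (dot b u).
  by exists b, a; split => //; rewrite ger0_norm ?subr_ge0//; lra.
by exists a, b; split => //; rewrite ltr0_norm ?subr_lt0//; lra.
Qed.

End BoundaryChains.

(** * The perimeter of a disk *)

Section DiskPerimeter.
Context {R : realType}.
Implicit Types (c x : 'rV[R]_2) (r : R).

Definition polar (a : R) : 'rV[R]_2 :=
  cos a *: delta_mx 0 0 + sin a *: delta_mx 0 1.

Lemma polar0 (a : R) : polar a 0 0 = cos a.
Proof. by rewrite !mxE/= mulr1 mulr0 addr0. Qed.

Lemma polar1 (a : R) : polar a 0 1 = sin a.
Proof. by rewrite !mxE/= mulr1 mulr0 add0r. Qed.

Lemma enorm_polar (a : R) : enorm (polar a) = 1.
Proof.
by rewrite enormE /dot polar0 polar1 -!expr2 cos2Dsin2 sqrtr1.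
Qed.

Lemma enorm_polarB (a h : R) : enorm (polar (a + h) - polar (a - h)) = 2 * `|sin h|.
Proof.
rewrite enormE -[2]ger0_norm// -normrM -sqrtr_sqr; congr Num.sqrt.
transitivity ((2 * sin h) ^+ 2 * (cos a ^+ 2 + sin a ^+ 2)); last by rewrite cos2Dsin2 mulr1.
rewrite /dot.
have subE i : (polar (a + h) - polar (a - h)) 0 i =
    polar (a + h) 0 i - polar (a - h) 0 i by rewrite !mxE.
by rewrite !subE !polar0 !polar1 cosD cosB sinD sinB; ring.
Qed.

Lemma polar_inj (a b : R) : 0 <= a < 2 * pi -> 0 <= b < 2 * pi -> polar a = polar b -> a = b.
Proof.
wlog ab : a b / b <= a.
  move=> H a2 b2 e; case: (leP b a) => [|/ltW] ba; first exact: H.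
  by apply/esym/H.
move=> /andP[a0 a2] /andP[b0 b2] e; apply/eqP; rewrite eq_le ab andbT leNgt; apply/negP => ba.
have : 2 * `|sin ((a - b) / 2)| = 0.
  rewrite -(enorm_polarB ((a + b) / 2)).
  have -> : (a + b) / 2 + (a - b) / 2 = a by field.
  have -> : (a + b) / 2 - (a - b) / 2 = b by field.
  by rewrite e subrr enormE /dot !mxE !mul0r addr0 sqrtr0.
have : 0 < sin ((a - b) / 2) by apply: sin_gt0_pi; lra.
by move=> s0 /eqP; rewrite mulf_eq0 pnatr_eq0/= normr_eq0 gt_eqF.
Qed.

Lemma polar_surj x : enorm x = 1 -> exists2 a, 0 <= a <= 2 * pi & polar a = x.
Proof.
move=> x1; have : x 0 0 ^+ 2 + x 0 1 ^+ 2 = 1.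
  by rewrite !expr2 -/(dot x x) -sqr_enorm x1 expr1n.
move=> e.
have x01 : -1 <= x 0 0 <= 1.
  by rewrite -ler_norml -sqrtr_sqr -[leRHS]sqrtr1 ler_wsqrtr// -e lerDl sqr_ge0.
have a0 := acos_ge0 x01; have api := acos_lepi x01.
have c := acosK (_ : x 0 0 \in `[(-1), 1]); rewrite in_itv/= in c.
have s : sin (acos (x 0 0)) = `|x 0 1|.
  by rewrite sin_acos// -e addrAC subrr add0r sqrtr_sqr.
have pi0 := pi_gt0 R.
have [y0|y0] := leP 0 (x 0 1).
  exists (acos (x 0 0)); first by lra.
  by apply: eq_rV2; rewrite ?polar0 ?polar1 ?c// s ger0_norm.
exists (2 * pi - acos (x 0 0)); first by lra.
rewrite (_ : 2 * pi - _ = - acos (x 0 0) + pi *+ 2); last by rewrite mulr2n; ring.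
apply: eq_rV2; rewrite ?polar0 ?polar1.
  by rewrite (cosD2pi _) cosN c.
by rewrite (sinD2pi _) sinN s ltr0_norm// opprK.
Qed.

(** A point at distance r from c is the limit, as t tends to 1 from above, of its
    images by the homotheties of centre c and ratio t, which are outside the
    disk. *)
Lemma boundary_disk c r : 0 < r -> boundary (closed_disk c r) = [set x | enorm (x - c) = r].
Proof.
move=> r0.
have cn := @continuous_enormB R c.
have clD : closed (closed_disk c r).
  rewrite (_ : closed_disk c r = (fun x => enorm (x - c)) @^-1` [set y | y <= r])//.
  by apply: preimage_closed => //; exact: closed_le.
rewrite /boundary -(closure_id _).1//; apply/seteqP; split => x /=.
  move=> [xr nx]; apply/eqP; rewrite eq_le xr/= leNgt; apply/negP => lt.
  apply: nx; rewrite /interior/=.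
  have H : \forall y \near x, enorm (y - c) < r by exact: (cvgr_lt _ (cn x)).
  by near=> y; rewrite /closed_disk/=; apply: ltW; near: y.
move=> xr; split; first by rewrite /closed_disk/= xr.
rewrite /interior /= => nx.
pose g (t : R) := c + t *: (x - c).
have cg : g t @[t --> (1 : R)] --> x.
  rewrite [X in _ --> X](_ : x = c + 1 *: (x - c)); last by rewrite scale1r addrC subrK.
  exact: (cvgD (cvg_cst c) (cvgZ cvg_id (cvg_cst (x - c)))).
have /nbhs_ballP[e /= e0 eD] := cg _ nx.
have e2 : 0 < e / 2 by rewrite divr_gt0.
have : closed_disk c r (g (1 + e / 2)).
  apply: eD; rewrite /ball/= opprD addrA subrr add0r normrN gtr0_norm//.
  by rewrite ltr_pdivrMr// ltr_pMr// ltrDl.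
rewrite /closed_disk/= /g addrC addKr enormZ xr ger0_norm; last by rewrite addr_ge0// ltW.
by rewrite mulrDl mul1r gerDl leNgt mulr_gt0.
Unshelve. all: by end_near. Qed.

Lemma segment_collinear (a b x y z : 'rV[R]_2) : segment a b x -> segment a b y ->
  segment a b z -> cross (y - x) (z - x) = 0.
Proof.
by move=> [t _ <-] [t' _ <-] [t2 _ <-]; rewrite /cross !mxE; ring.
Qed.

(** The centre and the points of polar angles 0 and pi / 2 are not collinear. *)
Lemma disk_not_segment c r : 0 < r -> ~ exists a b, closed_disk c r = segment a b.
Proof.
move=> r0 [a [b e]].
have D t : segment a b (c + r *: polar t).
  by rewrite -e /closed_disk/= addrC addKr enormZ enorm_polar mulr1 gtr0_norm.
have Dc : segment a b c.
  by rewrite -e /closed_disk/= subrr enormE /dot !mxE mul0r addr0 sqrtr0 ltW.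
have := segment_collinear Dc (D 0) (D (pi / 2)).
rewrite ![c + _]addrC !addrK /cross !mxE/= cos0 sin0 cos_pihalf sin_pihalf => /eqP.
by apply/negP; rewrite !(mulr0, mulr1, mul0r, addr0, add0r, subr0) mulf_neq0// gt_eqF.
Qed.

Definition circle_param c r (t : R) : 'rV[R]_2 := c + r *: polar (2 * pi * t).

Lemma continuous_circle_param c r : continuous (circle_param c r).
Proof.
move=> t; pose e0 : 'rV[R]_2 := delta_mx 0 0; pose e1 : 'rV[R]_2 := delta_mx 0 1.
have ca : 2 * pi * t0 @[t0 --> t] --> 2 * pi * t.
  exact: (cvgM (cvg_cst (2 * pi)) cvg_id).
have cc : cos (2 * pi * t0) *: e0 @[t0 --> t] --> cos (2 * pi * t) *: e0.
  by apply: cvgZ; [exact: (cvg_comp _ _ ca (@continuous_cos R _))|exact: cvg_cst].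
have cs : sin (2 * pi * t0) *: e1 @[t0 --> t] --> sin (2 * pi * t) *: e1.
  by apply: cvgZ; [exact: (cvg_comp _ _ ca (@continuous_sin R _))|exact: cvg_cst].
have cp : polar (2 * pi * t0) @[t0 --> t] --> polar (2 * pi * t) by exact: (cvgD cc cs).
have crp : r *: polar (2 * pi * t0) @[t0 --> t] --> r *: polar (2 * pi * t).
  by apply: cvgZ => //; exact: cvg_cst.
exact: (cvgD (cvg_cst c) crp).
Qed.

Lemma circle_param_simple c r : 0 < r ->
  simple_closed_parametrization (boundary (closed_disk c r)) (circle_param c r).
Proof.
move=> r0; rewrite boundary_disk//; split.
- exact/continuous_subspaceT/continuous_circle_param.
- rewrite /circle_param mulr0 mulr1; congr (_ + _ *: _).
  by apply: eq_rV2; rewrite ?polar0 ?polar1 mulr_natl ?cos2pi ?sin2pi ?cos0 ?sin0.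
- move=> a b; rewrite !inE /= !in_itv/= => /andP[a0 a1] /andP[b0 b1].
  move=> /addrI/(scalerI (lt0r_neq0 r0)) e.
  have p0 : 0 < 2 * pi :> R by rewrite mulr_gt0// pi_gt0.
  apply: (mulfI (lt0r_neq0 p0)); apply: polar_inj e.
    by rewrite mulr_ge0 ?(ltW p0)//= gtr_pMr.
  by rewrite mulr_ge0 ?(ltW p0)//= gtr_pMr.
- apply/seteqP; split => x /=.
    move=> [t _ <-]; rewrite /circle_param addrC addKr enormZ enorm_polar mulr1.
    by rewrite gtr0_norm.
  move=> xr; have [|a a2 ae] := @polar_surj (r^-1 *: (x - c)).
    by rewrite enormZ xr ger0_norm ?invr_ge0 ?ltW// mulVf// gt_eqF.
  have p0 : 0 < 2 * pi :> R by rewrite mulr_gt0// pi_gt0.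
  exists (a / (2 * pi)).
    move: a2 => /andP[a0 a2]; rewrite in_itv/= divr_ge0 ?(ltW p0)//=.
    by rewrite ler_pdivrMr// mul1r.
  rewrite /circle_param mulrC divfK ?lt0r_neq0// ae scalerA divff ?lt0r_neq0//.
  by rewrite scale1r addrC subrK.
Qed.

Lemma inscribed_polygon_chain c r N : 0 < r -> (0 < N)%N ->
  exists2 s, itv_partition 0 1 s &
    chain_length (circle_param c r) 0 1 s = (2 * N)%:R * r * sin (pi / N%:R).
Proof.
move=> r0 N0; have N0' : 0 < N%:R :> R by rewrite ltr0n.
pose s := [seq i.+1%:R / N%:R : R | i <- iota 0 N].
have sz : size s = N by rewrite size_map size_iota.
have nths i : (i <= N)%N -> nth 1 (0 :: s) i = i%:R / N%:R.
  case: i => [|i] iN; first by rewrite mul0r.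
  by rewrite /= (nth_map 0%N) ?size_iota// nth_iota.
exists s.
  split.
    apply/(pathP 1) => i; rewrite sz => iN.
    rewrite (nths i (ltnW iN)) -[nth 1 s i]/(nth 1 (0 :: s) i.+1) nths//.
    by rewrite ltr_pM2r ?invr_gt0// ltr_nat.
  by rewrite (last_nth 1) sz nths// divff// gt_eqF.
rewrite /chain_length sz /=.
transitivity (\sum_(0 <= i < N) (2 * r * sin (pi / N%:R))); last first.
  by rewrite sumr_const_nat subn0 -mulr_natl natrM; ring.
apply: eq_big_nat => i /andP[_ iN].
rewrite -[nth 1 s i]/(nth 1 (0 :: s) i.+1) !nths ?(ltnW iN)//.
rewrite /circle_param opprD addrACA subrr add0r -scalerBr enormZ gtr0_norm//.
pose h : R := pi / N%:R.
have -> : 2 * pi * (i.+1%:R / N%:R) = (2 * i%:R + 1) * h + h.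
  by rewrite /h -natr1; field; rewrite gt_eqF.
have -> : 2 * pi * (i%:R / N%:R) = (2 * i%:R + 1) * h - h.
  by rewrite /h; field; rewrite gt_eqF.
rewrite enorm_polarB ger0_norm; first by rewrite /h; ring.
rewrite /h; apply: sin_ge0_pi; rewrite divr_ge0 ?pi_ge0//=.
by rewrite ler_pdivrMr// ler_peMr ?pi_ge0// ler1n.
Qed.

(** The regular N-gon inscribed in the circle has perimeter 2 N r sin (pi / N).
    For r = 0 the disk is the degenerate segment from c to c. *)
Lemma polygon_le_perimeter_disk c r N : 0 <= r -> (0 < N)%N ->
  (((2 * N)%:R * r * sin (pi / N%:R))%:E <= perimeter (closed_disk c r))%E.
Proof.
rewrite le_eqVlt => /predU1P[<-|r0] N0.
  rewrite mulr0 mul0r /perimeter.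
  have dE : closed_disk c 0 = segment c c.
    apply/seteqP; split => x.
      rewrite /closed_disk/= => x0.
      have /enorm_eq0/eqP : enorm (x - c) = 0 by apply/eqP; rewrite eq_le x0 enorm_ge0.
      rewrite subr_eq0 => /eqP ->.
      exists 0; first by rewrite /= in_itv/= lexx ler01.
      by rewrite subr0 scale1r scale0r addr0.
    move=> [t _ <-]; rewrite -scalerDl subrK scale1r /closed_disk/= subrr.
    by rewrite enormE /dot !mxE mul0r addr0 sqrtr0.
  case: asboolP => [_|]; last by case; exists c, c.
  apply: mule_ge0 => //; apply: ereal_sup_ubound; exists c, c; split => //.
  by rewrite subrr enormE /dot !mxE mul0r addr0 sqrtr0.
rewrite /perimeter; case: asboolP => [/(disk_not_segment r0)//|_].
have [s ps <-] := inscribed_polygon_chain c r0 N0.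
apply: (@le_trans _ _ (curve_length (circle_param c r) 0 1)).
  by apply: ereal_sup_ubound; exists s.
apply: ereal_sup_ubound; exists (circle_param c r) => //.
exact: circle_param_simple.
Qed.

End DiskPerimeter.

(** * Comparison of the perimeters *)

(** The angle pi / 2N tends to 0 and cos is continuous. *)
Lemma le_of_cos_le {R : realType} (L l : R) :
  (forall N, (0 < N)%N -> L * cos (pi / (2 * N)%:R) <= l) -> L <= l.
Proof.
move=> Ll.
have h0 : pi / 2 * @harmonic R n @[n --> \oo] --> 0.
  rewrite -[X in _ --> X](mulr0 (pi / 2)).
  exact: (cvgM (cvg_cst (pi / 2)) cvg_harmonic).
have : L * cos (pi / 2 * @harmonic R n) @[n --> \oo] --> L.
  have cc : cos (pi / 2 * @harmonic R n) @[n --> \oo] --> cos (0 : R).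
    exact: (cvg_comp _ _ h0 (@continuous_cos R _)).
  by rewrite -[X in _ --> X]mulr1; rewrite cos0 in cc; exact: (cvgM (cvg_cst L) cc).
move/cvgr_to_le; apply; near=> n.
rewrite /harmonic/= -mulrA -invfM -natrM; exact: Ll.
Unshelve. all: by end_near. Qed.

(** Both sides of the comparison are polygonal: for every N, the bound that
    [width_bounds_le] gives for L cos (pi / 2N) is the perimeter of the 2N-gon
    inscribed in D.  The value of pi therefore never has to be related to
    lengths. *)
Lemma width_bounds_le_perimeter {R : realType} (P Q D : set 'rV[R]_2) vs :
  convex_shape Q -> largest_disk Q D -> placeable_in_every_orientation P Q ->
  width_bounds vs P -> ((\sum_(v <- vs) enorm v)%:E <= perimeter D)%E.
Proof.
move=> cQ [c [r [r0 -> _ rmax]]] PQ wvs; set L := \sum_(v <- vs) _.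
have LN N : (0 < N)%N ->
    ((L * cos (pi / (2 * N)%:R))%:E <= perimeter (closed_disk c r))%E.
  move=> N0; apply: le_trans (polygon_le_perimeter_disk c r0 (N := (2 * N)%N) _).
    rewrite lee_fin mulnA; exact: (width_bounds_le cQ PQ wvs N0 rmax).
  by rewrite muln_gt0.
move: LN; case: (perimeter _) => [l LN| |LN].
- by rewrite lee_fin; apply: le_of_cos_le => N N0; rewrite -lee_fin; exact: LN.
- by rewrite leey.
- by have := LN 1%N isT.
Qed.

Theorem theorem7 (R : realType) (P Q D : set 'rV[R]_2)
    (hQ : convex_shape Q)
    (hD : largest_disk Q D)
    (hP : convex_shape P)
    (hPQ : placeable_in_every_orientation P Q) :
  (perimeter P <= perimeter D)%E.
Proof.
have bound vs := @width_bounds_le_perimeter R P Q D vs hQ hD hPQ.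
rewrite [perimeter P]/perimeter; case: asboolP => _.
  rewrite -lee_pdivlMl//; apply: ub_ereal_sup => _ [a [b [PE ->]]].
  rewrite lee_pdivlMl//.
  have := bound [:: b - a; b - a]; rewrite PE => /(_ (segment_width_bounds a b)).
  by rewrite !big_cons big_nil addr0 -EFinM mulr_natl mulr2n.
apply: ub_ereal_sup => _ [gamma hgamma <-].
apply: ub_ereal_sup => _ [s hs <-].
by rewrite chain_lengthE; apply/bound/boundary_chain_width_bounds.
Qed.
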